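(* For $p=000$, we have $$C_p(x,y)=\frac{1-x^2-x^2y}{1-x-2x^2-x^2y+x^3+x^4-x^4y}.$$
   Context: A Catalan word of length $n\geq 1$ is a word $w_1\ldots w_n$ over the non-negative integers with $w_1=0$ and $0\leq w_i\leq w_{i-1}+1$ for $2\leq i\leq n$; the empty word is the unique Catalan word of length $0$. A word $w$ contains the pattern $p=p_1\ldots p_k$ if there are indices $i_1<\cdots<i_k$ such that $w_{i_1}\ldots w_{i_k}$ is order-isomorphic to $p$ (for all $a,b$: $w_{i_a}<w_{i_b}$ iff $p_a<p_b$, and $w_{i_a}=w_{i_b}$ iff $p_a=p_b$); otherwise $w$ avoids $p$. $\mathcal{C}_n(p)$ is the set of Catalan words of length $n$ avoiding $p$. A descent of $w$ is an index $i$ with $w_i>w_{i+1}$. $C_p(x,y)=\sum_{n,k\geq 0}c_{n,k}x^ny^k$, where $c_{n,k}$ is the number of words in $\mathcal{C}_n(p)$ with exactly $k$ descents. *)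

(* Defs.v *)
From HB Require Import structures.
From mathcomp Require Import all_boot all_order all_algebra.
From mathcomp Require Import boolp.

Set Implicit Arguments.
Unset Strict Implicit.
Unset Printing Implicit Defensive.

Import GRing.Theory.
Local Open Scope ring_scope.

Record fps (R : Type) := Fps { fcoef : nat -> R }.

HB.instance Definition _ (R : Type) := gen_eqMixin (fps R).
HB.instance Definition _ (R : Type) := gen_choiceMixin (fps R).

Lemma fpsP (R : Type) (f g : fps R) :
  (forall n, fcoef f n = fcoef g n) <-> f = g.
Proof.
split=> [|-> //]; case: f g => [f] [g] /= fg.
by congr Fps; apply/funext.
Qed.

Definition fps_zero (R : comUnitRingType) : fps R := Fps (fun=> 0).
Definition fps_opp (R : comUnitRingType) (f : fps R) : fps R :=
  Fps (fun n => - fcoef f n).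
Definition fps_add (R : comUnitRingType) (f g : fps R) : fps R :=
  Fps (fun n => fcoef f n + fcoef g n).

Fact fps_addA (R : comUnitRingType) : associative (@fps_add R).
Proof. by move=> f g h; apply/fpsP => n /=; rewrite addrA. Qed.
Fact fps_addC (R : comUnitRingType) : commutative (@fps_add R).
Proof. by move=> f g; apply/fpsP => n /=; rewrite addrC. Qed.
Fact fps_add0 (R : comUnitRingType) : left_id (fps_zero R) (@fps_add R).
Proof. by move=> f; apply/fpsP => n /=; rewrite add0r. Qed.
Fact fps_addN (R : comUnitRingType) :
  left_inverse (fps_zero R) (@fps_opp R) (@fps_add R).
Proof. by move=> f; apply/fpsP => n /=; rewrite addNr. Qed.

HB.instance Definition _ (R : comUnitRingType) :=
  GRing.isZmodule.Build (fps R)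
    (@fps_addA R) (@fps_addC R) (@fps_add0 R) (@fps_addN R).

Definition fpsC (R : comUnitRingType) (c : R) : fps R :=
  Fps (fun n => if n is 0%N then c else 0).
Definition fpsX (R : comUnitRingType) : fps R := Fps (fun n => (n == 1%N)%:R).

Definition fps_mul (R : comUnitRingType) (f g : fps R) : fps R :=
  Fps (fun n => \sum_(i < n.+1) fcoef f i * fcoef g (n - i)%N).

Fact fps_mulC (R : comUnitRingType) : commutative (@fps_mul R).
Proof.
move=> f g; apply/fpsP => n /=; rewrite (reindex_inj rev_ord_inj) /=.
by apply: eq_bigr => i _; rewrite subSS subKn ?leq_ord // mulrC.
Qed.

Lemma fcoef_mul_rev (R : comUnitRingType) (f g : fps R) n :
  fcoef (fps_mul f g) n = \sum_(i < n.+1) fcoef f (n - i)%N * fcoef g i.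
Proof. by rewrite fps_mulC /=; apply: eq_bigr => i _; rewrite mulrC. Qed.

Fact fps_mulA (R : comUnitRingType) : associative (@fps_mul R).
Proof.
move=> p q r; apply/fpsP => i; rewrite [RHS]fcoef_mul_rev.
pose coef3 j k := fcoef p j * (fcoef q (i - j - k)%N * fcoef r k).
transitivity (\sum_(j < i.+1) \sum_(k < i.+1 | (k <= i - j)%N) coef3 j k).
  apply: eq_bigr => j _; rewrite fcoef_mul_rev big_distrr /=.
  by rewrite (big_ord_narrow_leq (leq_subr _ _)).
rewrite (exchange_big_dep predT) //=; apply: eq_bigr => k _.
transitivity (\sum_(j < i.+1 | (j <= i - k)%N) coef3 j k).
  apply: eq_bigl => j; rewrite -ltnS -(ltnS j) -!subSn ?leq_ord //.
  by rewrite -subn_gt0 -(subn_gt0 j) -!subnDA addnC.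
rewrite (big_ord_narrow_leq (leq_subr _ _)) big_distrl /=.
by apply: eq_bigr => j _; rewrite /coef3 -!subnDA addnC mulrA.
Qed.

Fact fps_mul1 (R : comUnitRingType) : left_id (fpsC (1 : R)) (@fps_mul R).
Proof.
move=> f; apply/fpsP => n /=; rewrite big_ord_recl /= mul1r subn0.
by rewrite big1 ?addr0 // => i _; rewrite mul0r.
Qed.

Fact fps_mulDl (R : comUnitRingType) :
  left_distributive (@fps_mul R) (@fps_add R).
Proof.
move=> f g h; apply/fpsP => n /=; rewrite -big_split /=.
by apply: eq_bigr => i _; rewrite mulrDl.
Qed.

Fact fps1_neq0 (R : comUnitRingType) : fpsC (1 : R) != 0.
Proof.
by apply/eqP => /fpsP /(_ 0%N) /= /eqP; rewrite oner_eq0.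
Qed.

HB.instance Definition _ (R : comUnitRingType) :=
  GRing.Zmodule_isComNzRing.Build (fps R) (@fps_mulA R) (@fps_mulC R)
    (@fps_mul1 R) (@fps_mulDl R) (@fps1_neq0 R).

(* The coefficients g_0, ..., g_n of 1/f, obtained by solving
   g_0 f_n + ... + g_n f_0 = (n == 0) for g_n. *)
Fixpoint fps_inv_seq (R : comUnitRingType) (f : fps R) (n : nat) : seq R :=
  if n is m.+1 then
    let s := fps_inv_seq f m in
    rcons s (- (fcoef f 0)^-1 * \sum_(i < m.+1) s`_i * fcoef f (m.+1 - i)%N)
  else [:: (fcoef f 0)^-1].

Definition fps_unit (R : comUnitRingType) : {pred fps R} :=
  fun f => fcoef f 0 \is a GRing.unit.

(* As everywhere in MathComp, the inverse of a non-unit is itself. *)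
Definition fps_inv (R : comUnitRingType) (f : fps R) : fps R :=
  if f \in @fps_unit R then Fps (fun n => (fps_inv_seq f n)`_n) else f.

Lemma size_fps_inv_seq (R : comUnitRingType) (f : fps R) n :
  size (fps_inv_seq f n) = n.+1.
Proof. by elim: n => //= n IHn; rewrite size_rcons IHn. Qed.

Lemma nth_fps_inv_seq (R : comUnitRingType) (f : fps R) n i :
  (i <= n)%N -> (fps_inv_seq f n)`_i = (fps_inv_seq f i)`_i.
Proof.
elim: n => [|n IHn]; first by case: i.
rewrite leq_eqVlt => /predU1P[-> //|lt_in].
by rewrite /= nth_rcons size_fps_inv_seq lt_in IHn.
Qed.

Fact fps_mulV (R : comUnitRingType) :
  {in @fps_unit R, left_inverse 1 (@fps_inv R) *%R}.
Proof.
move=> f uf; rewrite /fps_inv uf; apply/fpsP => n.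
have uf0 : fcoef f 0 \is a GRing.unit by [].
rewrite [LHS]/= big_ord_recr /= subnn; case: n => [|n].
  by rewrite big_ord0 add0r mulVr.
rewrite {2}/fps_inv_seq -/fps_inv_seq nth_rcons size_fps_inv_seq ltnn eqxx.
rewrite mulrAC mulNr mulVr // mulN1r; apply/eqP; rewrite subr_eq0; apply/eqP.
by apply: eq_bigr => i _; rewrite [in RHS]nth_fps_inv_seq // -ltnS.
Qed.

Fact fps_unitPl (R : comUnitRingType) (f g : fps R) :
  g * f = 1 -> fps_unit f.
Proof.
move=> /fpsP /(_ 0%N) /=; rewrite big_ord1 /= => gf1.
by apply/unitrPr; exists (fcoef g 0); rewrite mulrC.
Qed.

Fact fps_inv_out (R : comUnitRingType) :
  {in [predC @fps_unit R], @fps_inv R =1 id}.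
Proof. by move=> f /negbTE nuf; rewrite /fps_inv nuf. Qed.

HB.instance Definition _ (R : comUnitRingType) :=
  GRing.ComNzRing_hasMulInverse.Build (fps R)
    (@fps_mulV R) (@fps_unitPl R) (@fps_inv_out R).

(* Z[[x, y]] as Z[[y]][[x]]: the coefficient of x^n y^k in f is
   fcoef (fcoef f n) k. *)
Notation fps2 := (fps (fps int)).

Definition fps2_x : fps2 := fpsX (fps int).
Definition fps2_y : fps2 := fpsC (fpsX int).

Local Open Scope nat_scope.

Definition catalan (w : seq nat) : bool :=
  if w is a :: s then (a == 0) && path (fun u v => v <= u.+1) a s else true.

Definition contains (w p : seq nat) : bool :=
  [exists i : {ffun 'I_(size p) -> 'I_(size w)},
    forall a : 'I_(size p), forall b : 'I_(size p),
    [&& (a < b) ==> (i a < i b),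
        (nth 0 w (i a) < nth 0 w (i b)) == (nth 0 p a < nth 0 p b) &
        (nth 0 w (i a) == nth 0 w (i b)) == (nth 0 p a == nth 0 p b)]].

Definition avoids (w p : seq nat) : bool := ~~ contains w p.

Definition descents (w : seq nat) : nat :=
  count (fun i => nth 0 w i.+1 < nth 0 w i) (iota 0 (size w).-1).

Lemma catalan_lt_size (w : seq nat) :
  catalan w -> all (fun a => a < size w) w.
Proof.
case: w => // a s /andP[/eqP-> {a}].
suff aux k t : path (fun u v => v <= u.+1) k t ->
    all (fun a => a <= k + size t) t.
  by move=> /aux /= ->.
elim: t k => //= b t IHt k /andP[le_bk /IHt t_le]; apply/andP; split.
  by apply: leq_trans le_bk _; rewrite addnS ltnS leq_addr.
apply: sub_all t_le => a /leq_trans-> //.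
by rewrite addnS -addSn leq_add2r.
Qed.

(* By catalan_lt_size the letters of a Catalan word of length n are < n, so
   tuples over 'I_n represent all Catalan words of length n. *)
Definition catalan_avoiding (n : nat) (p : seq nat) : {set n.-tuple 'I_n} :=
  [set t : n.-tuple 'I_n | catalan (map val t) && avoids (map val t) p].

Definition catalan_count (p : seq nat) (n k : nat) : nat :=
  #|[set t in catalan_avoiding n p | descents (map val t) == k]|.

Definition catalan_gf (p : seq nat) : fps2 :=
  Fps (fun n => Fps (fun k => (catalan_count p n k)%:Z)).

(* Main.v *)
(** Let [C] be the generating function of the words in question and [D] that of
    the pairs [(u, v)] of nonempty Catalan words using each letter at most twice
    in total, with [y] marking the descents of [u] and of [v].  A nonempty word
    has one 0 and is [0 (w+1)], or has two and is [0 (u+1) 0 (v+1)], with a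
    descent before the second 0 iff [u] is nonempty.  Both words of a pair start
    with 0, which is then exhausted.  Hence
      C = 1 + x C + x^2 (C + y (C - 1) + y D),   D = x^2 (2 C - 1 + D),
    and eliminating [D] gives the fraction. *)
Require Import Defs.
From HB Require Import structures.
From mathcomp Require Import all_boot all_order all_algebra.
From mathcomp Require Import zify ring.
Import GRing.Theory.
Local Open Scope ring_scope.

Section Words.
Local Open Scope nat_scope.

(** * Avoidance of 000 as a bound on multiplicities *)

Definition thin (w : seq nat) := forall a, count_mem a w <= 2.

Lemma count_mem_nth (w : seq nat) a :
  count_mem a w = count (fun i => nth 0 w i == a) (iota 0 (size w)).
Proof. by rewrite -{1}(mkseq_nth 0 w) /mkseq count_map. Qed.

Lemma avoids000P w : reflect (thin w) (avoids w [:: 0; 0; 0]).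
Proof.
apply: (iffP idP) => [av a | thw].
  rewrite leqNgt; apply/negP; rewrite count_mem_nth -size_filter.
  (* [s] lists the positions of [a] in increasing order; its first three entries give the occurrence
     of 000. *)
  set s := filter _ _ => s3; case/negP: av.
  have sP i : i < 3 -> nth 0 s i \in s by move=> i3; rewrite mem_nth // (leq_trans i3).
  have sw i : i < 3 -> nth 0 s i < size w.
    by move=> /sP; rewrite mem_filter mem_iota => /andP[].
  have sa i : i < 3 -> nth 0 w (nth 0 s i) = a.
    by move=> /sP; rewrite mem_filter => /andP[/eqP].
  have srt : sorted ltn s by apply: sorted_filter (iota_ltn_sorted _ _); apply: ltn_trans.
  apply/existsP; exists [ffun i : 'I_3 => Ordinal (sw i (ltn_ord i))].
  apply/forallP => i; apply/forallP => j; rewrite !ffunE /= !sa ?ltn_ord // !eqxx ltnn.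
  have n0 k : k < 3 -> nth 0 [:: 0; 0; 0] k = 0 by case: k => [|[|[|]]].
  rewrite !n0 ?ltn_ord // !eqxx !andbT; apply/implyP => ij.
  by apply: (sorted_ltn_nth ltn_trans) => //; rewrite inE (leq_trans (ltn_ord _)).
apply/negP => /existsP[f /forallP fP].
have {}fP (i j : 'I_3) : i < j -> f i < f j /\ nth 0 w (f i) = nth 0 w (f j).
  move=> ij; have /forallP/(_ j)/and3P[/implyP/(_ ij) ? _] := fP i.
  have n0 k : k < 3 -> nth 0 [:: 0; 0; 0] k = 0 by case: k => [|[|[|]]].
  by rewrite !n0 ?ltn_ord // eqxx eqb_id => /eqP.
pose o k (lt : k < 3) : 'I_(size [:: 0; 0; 0]) := Ordinal lt.
have [lt01 e01] := fP (o 0 isT) (o 1 isT) isT.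
have [lt12 e12] := fP (o 1 isT) (o 2 isT) isT.
have := thw (nth 0 w (f (o 0 isT))); rewrite leqNgt => /negP; apply.
rewrite count_mem_nth -size_filter.
(* Three distinct positions lie in the list of all positions of this letter, which therefore has
   size above 2. *)
apply: (@uniq_leq_size _ [:: val (f (o 0 isT)); val (f (o 1 isT)); val (f (o 2 isT))]).
  by rewrite /= !inE; move: lt01 lt12 => /=; lia.
by apply/allP; rewrite /= !mem_filter !mem_iota !ltn_ord -e12 -e01 !eqxx.
Qed.

(** * Cutting words and pairs at their zeros *)

Definition lift (w : seq nat) := 0 :: map S w.
Definition glue (p : seq nat * seq nat) := lift p.1 ++ lift p.2.
Definition lift2 (p : seq nat * seq nat) := (lift p.1, lift p.2).

Lemma notin0_mapS s : 0 \notin map S s.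
Proof. by apply/mapP => -[]. Qed.

Lemma notin0_is_mapS s : 0 \notin s -> exists t, s = map S t.
Proof.
move=> s0; exists (map predn s); rewrite -map_comp map_id_in // => -[|a] //.
by rewrite (negPf s0).
Qed.

Lemma count_mapS a s : count_mem a (map S s) = if a is b.+1 then count_mem b s else 0.
Proof.
case: a => [|a]; first by apply/count_memPn/notin0_mapS.
by rewrite count_map; apply: eq_count => b /=; rewrite eqSS.
Qed.

Lemma lift_inj : injective lift.
Proof. by move=> u v [] /(inj_map succn_inj). Qed.

Lemma lift2_inj : injective lift2.
Proof. by move=> [u v] [u' v'] [] /(inj_map succn_inj)-> /(inj_map succn_inj)->. Qed.

(** The second 0 of the glued word marks where its second half starts, since shifted letters are
    positive. *)
Lemma glue_inj : injective glue.
Proof.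
move=> [u v] [u' v'] [] /= E.
have ix s t : index 0 (map S s ++ 0 :: t) = size s.
  by rewrite index_cat (negPf (notin0_mapS _)) /= addn0 size_map.
have su : size (map S u) = size (map S u').
  by rewrite !size_map -(ix u (map S v)) E ix.
move/eqP: E; rewrite eqseq_cat // eqseq_cons eqxx /= => /andP[/eqP+ /eqP].
by move=> /(inj_map succn_inj)-> /(inj_map succn_inj)->.
Qed.

Lemma path_lift k w :
  path (fun u v => v <= u.+1) k.+1 (map S w) = path (fun u v => v <= u.+1) k w.
Proof. by elim: w k => //= a w IH k; rewrite IH. Qed.

(** After a 0, a positive letter must be 1, which forces the unshifted word to begin with 0. *)
Lemma path_mapS0 w : path (fun u v => v <= u.+1) 0 (map S w) = catalan w.
Proof. by case: w => //= a w; rewrite path_lift; case: a. Qed.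

Lemma catalan_lift w : catalan (lift w) = catalan w.
Proof. by rewrite /= path_mapS0. Qed.

(** Dropping to 0 is always allowed, so the junction imposes no condition. *)
Lemma catalan_glue p : catalan (glue p) = catalan p.1 && catalan p.2.
Proof. by case: p => u v; rewrite /= cat_path /= !path_mapS0. Qed.

Lemma thin_lift w : thin (lift w) <-> thin w.
Proof.
split=> th a; first by have := th a.+1; rewrite /= count_mapS.
by rewrite /= count_mapS; case: a => [|a] //=; apply: th.
Qed.

(** The letter 0 occurs exactly twice; every other letter has its two uses shared between the
    halves, which is why pairs carry a joint condition. *)
Lemma thin_glue p : thin (glue p) <-> thin (p.1 ++ p.2).
Proof.
split=> th a; first by have := th a.+1; rewrite /= count_cat /= !count_mapS count_cat.
rewrite /= count_cat /= !count_mapS; case: a => [|a] //=.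
by have := th a; rewrite count_cat.
Qed.

(** Split at the second 0, if there is one; the bound leaves no further 0 on either side. *)
Lemma catalan_thin_decomp w : catalan w -> thin w ->
  [\/ w = [::], exists u, w = lift u | exists p, w = glue p].
Proof.
case: w => [|a s]; first by constructor.
move=> /andP[/eqP-> _] {a} th; have [s0|/notin0_is_mapS[t ->]] := boolP (0 \in s); last first.
  by constructor 2; exists t.
constructor 3; have := th 0; case/path.splitP: s0 => s1 s2.
rewrite /= cat_rcons count_cat /= => le2.
have /count_memPn/notin0_is_mapS[u ->] : count_mem 0 s1 = 0 by move: le2 => /=; lia.
have /count_memPn/notin0_is_mapS[v ->] : count_mem 0 s2 = 0 by move: le2 => /=; lia.
by exists (u, v).
Qed.

Lemma catalan_thin_pair_decomp u v : catalan u -> catalan v -> thin (u ++ v) ->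
  [\/ u = [::], v = [::] | exists p, (u, v) = lift2 p].
Proof.
case: u => [|a u]; first by constructor.
case: v => [|b v]; first by constructor.
move=> /andP[/eqP-> _] /andP[/eqP-> _] /(_ 0).
rewrite /= count_cat /= => le2.
have /count_memPn/notin0_is_mapS[u' ->] : count_mem 0 u = 0 by move: le2 => /=; lia.
have /count_memPn/notin0_is_mapS[v' ->] : count_mem 0 v = 0 by move: le2 => /=; lia.
by constructor 3; exists (u', v').
Qed.

(** * Enumeration of words and pairs by length *)

(* All admissible pairs of total length [n], given the words of length [n] and
   the pairs of nonempty words of total length [n]. *)
Definition add_empty n (ws : seq (seq nat)) (ps : seq (seq nat * seq nat)) :=
  if n is 0 then [:: ([::], [::])]
  else [seq ([::], w) | w <- ws] ++ [seq (w, [::]) | w <- ws] ++ ps.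

(** Explicit lists turn the decomposition into recurrences for sums over them. Both [glue] and
    [lift2] add two letters, hence [l]. *)
Fixpoint words n : seq (seq nat) :=
  if n is m.+1 then
    map lift (words m) ++
    (if m is l.+1 then map glue (add_empty l (words l) (pairs l)) else [::])
  else [:: [::]]
with pairs n : seq (seq nat * seq nat) :=
  if n is m.+1 then
    if m is l.+1 then map lift2 (add_empty l (words l) (pairs l)) else [::]
  else [::].

Definition word_spec n w := [/\ catalan w, thin w & size w = n].
Definition pair_spec n (p : seq nat * seq nat) :=
  [/\ catalan p.1, catalan p.2, thin (p.1 ++ p.2) & size p.1 + size p.2 = n].

Lemma mem_add_empty n ws ps :
    (forall w, w \in ws <-> word_spec n w) ->
    (forall p, p \in ps <-> [/\ pair_spec n p, p.1 <> [::] & p.2 <> [::]]) ->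
  forall p, p \in add_empty n ws ps <-> pair_spec n p.
Proof.
case: n => [|n] wsP psP [u v] /=.
  rewrite inE; split=> [/eqP[-> ->] | [_ _ _]] //=.
  by move/eqP; rewrite addn_eq0 => /andP[/nilP-> /nilP->].
rewrite !mem_cat; split.
  case/or3P=> [/mapP[w /wsP[cw tw sw] [-> ->]]|/mapP[w /wsP[cw tw sw] [-> ->]]|/psP[] //].
    by split.
  by split; rewrite //= ?cats0 ?addn0.
move=> [/= cu cv tuv suv]; apply/or3P.
have [u0|/eqP u0] := eqVneq u [::].
  by constructor 1; subst u; apply/mapP; exists v => //; apply/wsP.
have [v0|/eqP v0] := eqVneq v [::].
  constructor 2; subst v; apply/mapP; exists u => //; apply/wsP.
  by rewrite cats0 addn0 in tuv suv; split.
by constructor 3; apply/psP.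
Qed.

Lemma mem_words_pairs n :
  (forall w, w \in words n <-> word_spec n w) /\
  (forall p, p \in pairs n <-> [/\ pair_spec n p, p.1 <> [::] & p.2 <> [::]]).
Proof.
have szl w : size (lift w) = (size w).+1 by rewrite /= size_map.
have szg p : size (glue p) = (size p.1 + size p.2).+2.
  by rewrite size_cat !szl addnS.
(* Strong induction, because the recursion reaches back two lengths. *)
elim/ltn_ind: n => n IH; split; last first.
- move=> [u v]; case: n IH => [|[|n]] IH.
  + by split=> // -[[_ _ _]]; case: u.
  + by split=> // -[[_ _ _]]; case: u => // a [|b u]; case: v.
  have aeP : forall p, p \in add_empty n (words n) (pairs n) <-> pair_spec n p.
    by have [|wsP psP] := IH n; [lia | apply: mem_add_empty].
  rewrite [pairs _]/=; split.
    case/mapP=> -[u' v'] /aeP[cu cv tuv suv] [-> ->].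
    split=> //; split; rewrite ?catalan_lift //; first exact/(thin_glue (u', v')).
    by rewrite !szl addnS addSn suv.
  move=> [[/= cu cv tuv suv] u0 v0].
  case: (catalan_thin_pair_decomp _ _ cu cv tuv) => // -[[u' v'] [eu ev]].
  subst u v; apply/mapP; exists (u', v') => //; apply/aeP.
  split; [by rewrite -catalan_lift | by rewrite -catalan_lift | exact/thin_glue |].
  by move: suv; rewrite /= !size_map; lia.
move=> w; case: n IH => [|n] IH.
  by rewrite inE; split=> [/eqP-> | [_ _ /size0nil->]].
have [wsP _] := IH n (ltnSn n).
rewrite [words _]/= mem_cat; split.
  case/orP=> [/mapP[u /wsP[cu tu su] ->]|].
    by split; [rewrite catalan_lift | apply/thin_lift | rewrite szl su].
  case: n IH {wsP} => [|n] IH // /mapP[p pae ->].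
  have [|wsP psP] := IH n; first lia.
  have /(mem_add_empty _ _ _ wsP psP)[cu cv tuv suv] := pae.
  by split; [rewrite catalan_glue cu | apply/thin_glue | rewrite szg suv].
move=> [cw tw sw].
case: (catalan_thin_decomp _ cw tw) => [w0|[u wu]|[p wp]]; subst w => //.
  rewrite map_f //; apply/wsP; split; [by rewrite -catalan_lift | exact/thin_lift |].
  by move: sw; rewrite szl => -[].
case: n IH wsP sw => [|n] IH wsP; rewrite szg => // -[sp]; apply/orP; right.
have [|wsP' psP] := IH n; first lia.
apply/map_f/(mem_add_empty _ _ _ wsP' psP).
by split=> //; [have := cw | have := cw | exact/thin_glue]; rewrite catalan_glue => /andP[].
Qed.

Lemma mem_words n w : w \in words n <-> word_spec n w.
Proof. exact: (proj1 (mem_words_pairs n)). Qed.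

Lemma mem_pairs n p : p \in pairs n <-> [/\ pair_spec n p, p.1 <> [::] & p.2 <> [::]].
Proof. exact: (proj2 (mem_words_pairs n)). Qed.

(** In positive length the two components cannot both be empty, so the three blocks are disjoint. In
    length 0 they would list the empty pair twice, hence its separate case. *)
Lemma uniq_add_empty n :
  uniq (words n) -> uniq (pairs n) -> uniq (add_empty n (words n) (pairs n)).
Proof.
case: n => // n uw up; rewrite /add_empty !cat_uniq up.
rewrite !map_inj_uniq ?uw; [|by move=> ? ? []|by move=> ? ? []].
apply/and3P; split=> //; last rewrite andbT andTb; apply/hasPn => p.
  rewrite mem_cat => pP; apply/negP => /mapP[w /mem_words[_ _ sw] pE].
  case/orP: pP => [/mapP[w' /mem_words[_ _ sw']]|/mem_pairs[_]]; rewrite pE //.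
  by case=> w'0; rewrite -w'0 in sw'.
by move=> /mem_pairs[_ _ p2]; apply/negP => /mapP[w _ pE]; rewrite pE in p2.
Qed.

Lemma uniq_words_pairs n : uniq (words n) /\ uniq (pairs n).
Proof.
elim/ltn_ind: n => -[|n] IH //; have [uw _] := IH n (ltnSn n).
case: n IH uw => [|n] IH uw //.
have [|uw' up'] := IH n; first lia.
have uae := uniq_add_empty _ uw' up'.
split; last by rewrite /= map_inj_uniq //; apply: lift2_inj.
rewrite [words _]/= -/(words n.+1) cat_uniq !map_inj_uniq ?uw ?uae;
  [|exact: glue_inj|exact: lift_inj].
(* The images of [glue] and [lift] are told apart by their number of zeros, two against one. *)
rewrite andbT; apply/hasPn => _ /mapP[p _ ->]; apply/negP => /mapP[w _].
by move=> /(congr1 (count_mem 0)); rewrite /= count_cat /= !count_mapS.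
Qed.

(** * Descents and the passage to counts *)

Lemma descents_cons2 a b s : descents [:: a, b & s] = (b < a) + descents (b :: s).
Proof. by rewrite /descents /= -(addn0 1) iotaDl count_map. Qed.

Lemma descents_mapS s : descents (map S s) = descents s.
Proof.
case: s => // a s; elim: s a => // b s IH a.
by rewrite [map _ _]/= !descents_cons2 -IH.
Qed.

Lemma descents_lift w : descents (lift w) = descents w.
Proof. by rewrite -(descents_mapS w) /lift; case: w => // a w; rewrite [map _ _]/= descents_cons2. Qed.

Lemma descents_glue u v :
  descents (glue (u, v)) = descents u + (u != [::]) + descents v.
Proof.
rewrite -(descents_lift v) /glue /=; case: u => [|a u].
  by rewrite /= descents_cons2.
rewrite [map _ _]/= cat_cons descents_cons2 /= add0n.
rewrite -(descents_mapS (a :: u)) -addnA [map _ _]/=.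
(* The base case is the junction: the last letter of the shifted [u] is positive and the next letter
   is 0. *)
elim: u a => [|b u IH] a; first by rewrite descents_cons2.
by rewrite [map _ _]/= cat_cons !descents_cons2 IH addnA.
Qed.

Lemma catalan_count_words n k :
  catalan_count [:: 0; 0; 0] n k = count (fun w => descents w == k) (words n).
Proof.
rewrite /catalan_count cardE -(size_map (fun t : n.-tuple 'I_n => map val t)) -size_filter.
apply/perm_size/uniq_perm; rewrite ?filter_uniq //.
- rewrite map_inj_uniq ?enum_uniq // => s t /(inj_map val_inj); exact: val_inj.
- by have [] := uniq_words_pairs n.
move=> w; rewrite mem_filter; apply/mapP/andP => [[t]|[dw /mem_words[cw tw sw]]].
  rewrite mem_enum !inE => /andP[/andP[ct /avoids000P tt] dt] ->; split=> //.
  by apply/mem_words; split; rewrite // size_map size_tuple.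
have /allP ltw := catalan_lt_size cw.
(* All letters are below [n], so [insub] discards none of them and [w] comes from a tuple. *)
have wE : map val (pmap (insub : nat -> option 'I_n) w) = w.
  rewrite -[RHS]filter_predT pmap_filter; last exact: insubK.
  apply: eq_in_filter => a /ltw; rewrite sw => lta /=; by rewrite insubT.
have st : size (pmap (insub : nat -> option 'I_n) w) == n.
  by rewrite -(size_map val) wE sw.
exists (Tuple st); rewrite ?wE //.
by rewrite mem_enum !inE /= wE cw dw; have /avoids000P-> := tw.
Qed.

End Words.

(** * Coefficients of power series *)

Lemma fcoefD (R : comUnitRingType) (f g : fps R) n : fcoef (f + g) n = fcoef f n + fcoef g n.
Proof. by []. Qed.

Lemma fcoefB (R : comUnitRingType) (f g : fps R) n : fcoef (f - g) n = fcoef f n - fcoef g n.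
Proof. by []. Qed.

Lemma fcoef1 (R : comUnitRingType) n : fcoef (1 : fps R) n = (n == 0%N)%:R.
Proof. by case: n. Qed.

Lemma fcoef_sum (R : comUnitRingType) I (r : seq I) (F : I -> fps R) n :
  fcoef (\sum_(i <- r) F i) n = \sum_(i <- r) fcoef (F i) n.
Proof. by elim: r => [|i r IH]; rewrite ?big_nil // !big_cons fcoefD IH. Qed.

Lemma fcoefCM (R : comUnitRingType) (c : R) f n : fcoef (fpsC c * f) n = c * fcoef f n.
Proof.
by rewrite /= big_ord_recl /= subn0 big1 ?addr0 // => i _; rewrite mul0r.
Qed.

Lemma fcoefXM0 (R : comUnitRingType) (f : fps R) : fcoef (fpsX R * f) 0 = 0.
Proof. by rewrite /= big_ord1 /= mul0r. Qed.

Lemma fcoefXMS (R : comUnitRingType) (f : fps R) n : fcoef (fpsX R * f) n.+1 = fcoef f n.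
Proof.
rewrite /= !big_ord_recl /= mul0r mul1r subSS subn0 add0r big1 ?addr0 // => i _.
by rewrite mul0r.
Qed.

Lemma fcoefXn (R : comUnitRingType) d n : fcoef (fpsX R ^+ d) n = (d == n)%:R.
Proof.
elim: d n => [|d IH] n; first by rewrite fcoef1 eq_sym.
by rewrite exprS; case: n => [|n]; rewrite ?fcoefXM0 // fcoefXMS IH.
Qed.

(** * The functional equations *)

Lemma big_add_empty (V : nmodType) n ws ps (F : seq nat * seq nat -> V) :
  \sum_(p <- add_empty n.+1 ws ps) F p =
  \sum_(w <- ws) F ([::], w) + (\sum_(w <- ws) F (w, [::]) + \sum_(p <- ps) F p).
Proof. by rewrite !big_cat !big_map. Qed.

(** The series D of the overview; inside a coefficient of x^n, the variable y is [fpsX int]. *)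
Definition pairs_gf : fps2 :=
  Fps (fun n => \sum_(p <- pairs n) fpsX int ^+ (descents p.1 + descents p.2)).

Lemma catalan_gf_coef n :
  fcoef (catalan_gf [:: 0%N; 0%N; 0%N]) n = \sum_(w <- words n) fpsX int ^+ descents w.
Proof.
apply/fpsP => k; rewrite fcoef_sum /= catalan_count_words -sum1_count -[LHS]natz natr_sum.
by rewrite big_mkcond; apply: eq_bigr => w _; rewrite fcoefXn; case: eqP.
Qed.

(** Removing both zeros keeps all descents. The remaining pair has an empty component in 2C - 1
    ways, the -1 correcting for the empty pair, or is counted by D. *)
Lemma pairs_gf_eq (x := fps2_x) (c := catalan_gf [:: 0%N; 0%N; 0%N]) :
  pairs_gf = x ^+ 2 * (2%:R * c - 1 + pairs_gf).
Proof.
apply/fpsP => -[|[|n]]; rewrite expr2 -mulrA /x ?fcoefXM0 ?fcoefXMS ?fcoefXM0 ?fcoefXMS;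
  try by rewrite /= big_nil.
rewrite mulr2n mulrDl mul1r fcoefD fcoefB fcoefD fcoef1 catalan_gf_coef.
rewrite [fcoef pairs_gf n.+2]/= big_map.
under eq_bigr do rewrite /= !descents_lift.
case: n => [|n]; first by rewrite /= !big_seq1 big_nil addr0 addrK.
rewrite big_add_empty [(_ == _)%:R]/= subr0 addrA.
by congr (_ + _ + _); apply: eq_bigr => w _; rewrite addn0.
Qed.

(** In the [x ^+ 2] term, C stands for [u] empty, y (C - 1) for only [v] empty, and y D for neither;
    each y is the descent at the junction. *)
Lemma catalan_gf_eq (x := fps2_x) (y := fps2_y) (c := catalan_gf [:: 0%N; 0%N; 0%N]) :
  c = 1 + x * c + x ^+ 2 * (c + y * (c - 1) + y * pairs_gf).
Proof.
apply/fpsP => n; rewrite expr2 -[x * x * _]mulrA !fcoefD fcoef1.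
case: n => [|[|n]]; rewrite /x ?fcoefXM0 ?fcoefXMS ?fcoefXM0 ?fcoefXMS !catalan_gf_coef.
- by rewrite /= big_seq1 !addr0.
- by rewrite /= !big_seq1 add0r addr0.
rewrite add0r !fcoefD !fcoefCM fcoefB fcoef1 catalan_gf_coef.
rewrite [words n.+2]/= -/(words n.+1) big_cat /= !big_map; congr (_ + _).
  by apply: eq_bigr => w _; rewrite -/(lift w) descents_lift.
case: n => [|n]; first by rewrite /= !big_seq1 big_nil subrr !mulr0 !addr0.
rewrite big_add_empty [(_ == _)%:R]/= subr0 -addrA; congr (_ + _).
  by apply: eq_bigr => w _; rewrite -/(glue ([::], w)) descents_glue.
rewrite !big_distrr; congr (_ + _); rewrite !big_seq; apply: eq_bigr.
  move=> w /mem_words[_ _ sw]; rewrite -/(glue (w, [::])) descents_glue.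
  have -> : w != [::] by apply/eqP => w0; rewrite w0 in sw.
  by rewrite addn0 addn1 exprS.
move=> [u v] /mem_pairs[_ /= /eqP u0 _]; rewrite -/(glue (u, v)) descents_glue u0.
by rewrite -addnA addnCA add1n exprS.
Qed.

(** * Elimination and the closed form *)

Lemma eliminate_pairs (R : comUnitRingType) (x y c d : R) :
    c = 1 + x * c + x ^+ 2 * (c + y * (c - 1) + y * d) ->
    d = x ^+ 2 * (2%:R * c - 1 + d) ->
  c * (1 - x - 2%:R * x ^+ 2 - x ^+ 2 * y + x ^+ 3 + x ^+ 4 - x ^+ 4 * y) =
  1 - x ^+ 2 - x ^+ 2 * y.
Proof.
move=> /eqP; rewrite -subr_eq0 => /eqP ec /eqP; rewrite -subr_eq0 => /eqP ed.
apply/eqP; rewrite -subr_eq0; apply/eqP.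
(* The multipliers [1 - x ^+ 2] and [x ^+ 2 * y] of the two equations are chosen so that [d]
   cancels. *)
rewrite -[RHS](addr0 0) -[X in _ = X + _](mulr0 (1 - x ^+ 2)) -{1}ec.
rewrite -[X in _ = _ + X](mulr0 (x ^+ 2 * y)) -{1}ed.
ring.
Qed.

Theorem theorem10 :
  let x := fps2_x in
  let y := fps2_y in
  catalan_gf [:: 0%N; 0%N; 0%N] =
    (1 - x ^+ 2 - x ^+ 2 * y) /
    (1 - x - 2%:R * x ^+ 2 - x ^+ 2 * y + x ^+ 3 + x ^+ 4 - x ^+ 4 * y).
Proof.
move=> x y; rewrite -(eliminate_pairs _ _ _ _ _ catalan_gf_eq pairs_gf_eq) -/x -/y.
rewrite mulrK //.
set q := (X in X \is a _).
(* Factoring out [x] exhibits the constant coefficient 1, which makes the denominator a unit. *)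
have -> : q = 1 + x * (- 1 - 2%:R * x - x * y + x ^+ 2 + x ^+ 3 - x ^+ 3 * y).
  by rewrite /q; ring.
by rewrite unfold_in /= /fps_unit fcoefD fcoefXM0 addr0 unitr1.
Qed.
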